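(* Let $X$ be a real Banach space and let $f:\mathbb{R}\to X$ be arbitrary. Then there exists a set $N\subset\mathbb{R}$ of Lebesgue measure zero such that: if $x\in\mathbb{R}\setminus N$ and $mD^+(f,x)<\infty$, then $md(f,x)$ exists and $md(f,x)=mD^+(f,x)$.
   Context: For $f:\mathbb{R}\to X$ and $x\in\mathbb{R}$: $mD^{+}(f,x)=\limsup_{t\to0+}\frac{\|f(x+t)-f(x)\|}{t}\in[0,+\infty]$. The unilateral metric derivatives are $md_{\pm}(f,x)=\lim_{t\to0+}\frac{\|f(x\pm t)-f(x)\|}{t}$ (when the limit exists). If $md_+(f,x)$ and $md_-(f,x)$ exist and are equal, one says that the metric derivative $md(f,x)$ exists and sets $md(f,x)=md_+(f,x)$. *)

(* Defs.v *)
From HB Require Import structures.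
From mathcomp Require Import all_boot all_order all_algebra.
From mathcomp Require Import all_classical all_reals all_analysis.

Set Implicit Arguments.
Unset Strict Implicit.
Unset Printing Implicit Defensive.

Import Order.TTheory GRing.Theory Num.Theory.
Import numFieldNormedType.Exports.

Local Open Scope classical_set_scope.
Local Open Scope ring_scope.

Definition rquot (R : realType) (X : normedModType R) (f : R -> X) (x t : R)
  : R := `|f (x + t) - f x| / t.

Definition lquot (R : realType) (X : normedModType R) (f : R -> X) (x t : R)
  : R := `|f (x - t) - f x| / t.

Definition mDplus (R : realType) (X : normedModType R) (f : R -> X) (x : R)
  : \bar R := limf_esup (fun t : R => (rquot f x t)%:E) 0^'+.

Definition md_plus_exists (R : realType) (X : normedModType R)
  (f : R -> X) (x : R) : Prop := cvg (rquot f x t @[t --> 0^'+]).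

Definition md_minus_exists (R : realType) (X : normedModType R)
  (f : R -> X) (x : R) : Prop := cvg (lquot f x t @[t --> 0^'+]).

(* As [lim] is total, [md_plus], [md_minus] and [md] are only meaningful under
   the corresponding existence predicates; these require a finite limit. *)
Definition md_plus (R : realType) (X : normedModType R) (f : R -> X) (x : R)
  : R := lim (rquot f x t @[t --> 0^'+]).

Definition md_minus (R : realType) (X : normedModType R) (f : R -> X) (x : R)
  : R := lim (lquot f x t @[t --> 0^'+]).

Definition md_exists (R : realType) (X : normedModType R) (f : R -> X) (x : R)
  : Prop :=
  [/\ md_plus_exists f x, md_minus_exists f x & md_plus f x = md_minus f x].

Definition md (R : realType) (X : normedModType R) (f : R -> X) (x : R) : R :=
  md_plus f x.

(* Main.v *)
Require Import Defs.
From HB Require Import structures.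
From mathcomp Require Import all_boot all_order all_algebra.
From mathcomp Require Import all_classical all_reals all_analysis.
From mathcomp Require Import measurable_realfun ring lra.
Import Order.TTheory GRing.Theory Num.Theory.
Import numFieldNormedType.Exports.
Local Open Scope classical_set_scope.
Local Open Scope ring_scope.

(** The set where [mDplus f] is finite is a countable union of sets [S] of small
    diameter such that, for some [L], [|f (x + t) - f x| <= L t] whenever [x] is
    in [S] and [t > 0] is small; in particular [f] is [L]-Lipschitz on [S].

    Let [d_n] be dense in [S] and let [phi_n] be the McShane extension of
    [|f - f (d_n)|] from [S] to the line. By Radon-Nikodym, [phi_n] is the
    integral of some [rho_n] with [|rho_n| <= L]. Put [m := sup_n |rho_n|]. For
    [s <= t] in [S], [|f t - f s|] is at most the integral of [m] over [s, t],
    and it is at least [|phi_n t - phi_n s|]. Lebesgue differentiation then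
    shows that, at almost every [x] of [S], [|f (x + h) - f x| / |h|] tends to
    [m x] along the [h] with [x + h] in [S].

    At almost every [x] of [S] the set [S] is moreover not porous, so every
    [x + h] has a point [s] of [S] on its left at distance [o(|h|)]. The one-sided
    estimate at [s] gives [f (x + h) = f s + o(|h|)], hence the limit for all
    [h]. *)

(** * Bounded densities of Lipschitz functions *)

(** A density [g] of [nu] exceeds 1 only on a null set. On [E], where [g > 1], domination forces
    [nu E = mu E], a finite value, so [g - 1] is positive on [E] with integral 0. Truncating [g] at
    1 thus changes it only on a null set and makes it real-valued. *)
Lemma radon_nikodym_le1 d (T : measurableType d) (R : realType)
    (mu : {sigma_finite_measure set T -> \bar R})
    (nu : {finite_measure set T -> \bar R}) :
  (forall A, measurable A -> nu A <= mu A)%E ->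
  exists g : T -> R, [/\ measurable_fun setT g, (forall x, 0 <= g x <= 1) &
    forall A, measurable A -> nu A = (\int[mu]_(x in A) (g x)%:E)%E].
Proof.
move=> nu_le.
have numu : nu `<< mu.
  apply/null_content_dominatesP => A mA A0.
  by apply/eqP; rewrite eq_le measure_ge0 andbT -A0 nu_le.
have [g [g0 gfin gint gE]] := radon_nikodym_sigma_finite numu.
have mg : measurable_fun setT g by exact: measurable_int gint.
pose E := [set x | (1%:E < g x)%E].
have mE : measurable E by rewrite -[E]setTI; exact: emeasurable_fun_o_infty.
have gintE : mu.-integrable E g by exact: integrableS gint.
have mgE : measurable_fun E g by exact: measurable_int gintE.
have nuEE : nu E = mu E.
  apply/eqP; rewrite eq_le nu_le//= gE// -[X in (X <= _)%E]mul1e -integral_cst//.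
  by apply: ge0_le_integral => //= x /ltW.
have Efin : (mu E < +oo)%E by rewrite -nuEE ltey_eq fin_num_measure.
have int1 : mu.-integrable E (EFin \o cst 1).
  apply/integrableP; split; first exact/measurable_EFinP.
  by under eq_integral do rewrite /= normr1; rewrite integral_cst// mul1e.
have E0 : mu E = 0.
  have : (\int[mu]_(x in E) `|g x - (EFin \o cst 1%R) x| = 0)%E.
    rewrite (eq_integral (g \- (EFin \o cst 1%R)))%E; last first.
      by move=> x; rewrite inE => /ltW Ex; rewrite gee0_abs// sube_ge0.
    rewrite integralB// -gE// -[X in (_ - X)%E]/(\int[mu]_(x in E) cst 1%:E x)%E.
    by rewrite integral_cst// mul1e nuEE subee// ge0_fin_numE.
  move/ae_eq_integral_abs => /(_ mE) [].
    by apply: emeasurable_funB => //; exact/measurable_EFinP.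
  move=> N [mN N0 sN]; apply/eqP; rewrite eq_le measure_ge0 andbT -N0.
  apply: le_measure; rewrite ?inE// => x Ex; apply: sN => /= /(_ Ex)/= gx1.
  have {}gx1 : g x = 1%:E.
    by apply/eqP; rewrite -[1%:E]add0e -sube_eq//; apply/eqP.
  by move: Ex; rewrite /E/= gx1 ltxx.
exists (fun x => fine (mine (g x) 1%E)); split.
- apply: measurableT_comp => //; exact: measurable_mine.
- move=> x; rewrite -!lee_fin fineK.
    by rewrite ge_min lexx orbT le_min g0 lee01.
  by rewrite /mine; case: ifP.
- move=> A mA; rewrite gE//; apply: ae_eq_integral => //.
  + exact: measurable_funTS.
  + apply/measurable_EFinP/measurable_funTS; apply: measurableT_comp => //.
    exact: measurable_mine.
  + exists E; split => // x /= /not_implyP[_] /eqP; rewrite fineK; last first.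
      by rewrite /mine; case: ifP.
    have [gx1|gx1] := ltP (g x) 1%:E; first by rewrite eqxx.
    by rewrite /E/= lt_neqAle eq_sym gx1 => ->.
Qed.

Lemma lebesgue_stieltjes_itvoc {R : realType} (G : cumulative R R) (s t : R) :
  s <= t ->
  lebesgue_stieltjes_measure G (`]s, t]%classic : set R) = (G t - G s)%:E.
Proof.
move=> st; rewrite /lebesgue_stieltjes_measure /measure_extension.
by rewrite measurable_mu_extE/= ?wlength_itv_bnd//; exact: is_ocitv.
Qed.

(** Both sides are measures that agree on half-open intervals, and these determine a
    Lebesgue-Stieltjes measure. *)
Lemma lebesgue_stieltjes_additive {R : realType} (G H K : cumulative R R) :
  (forall x, K x = G x + H x) ->
  forall A : set R, measurable A ->
  (lebesgue_stieltjes_measure K A =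
  lebesgue_stieltjes_measure G A + lebesgue_stieltjes_measure H A)%E.
Proof.
move=> KGH A mA; rewrite -[RHS]measure_addE.
apply: lebesgue_stieltjes_measure_unique => //= X /ocitvP[->|[[s t] /= st ->]].
  by rewrite !measure0.
rewrite /=/measure_add/msum/= !big_ord_recr big_ord0/= add0e.
rewrite !lebesgue_stieltjes_itvoc ?ltW//= -EFinD !KGH.
by congr EFin; lra.
Qed.

(** The two monotonicity hypotheses make [G] and [x - G x] continuous generators of Stieltjes
    measures whose sum is Lebesgue measure. The measure of [G] is therefore dominated by Lebesgue
    measure; restricting it to []a, b]] makes it finite. *)
Lemma bounded_density {R : realType} (G : R -> R) (a b : R) :
  {homo G : x y / x <= y} -> {homo (fun x => x - G x) : x y / x <= y} ->
  exists g : R -> R, [/\ measurable_fun setT g, (forall x, 0 <= g x <= 1) &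
    forall s t, a <= s -> s <= t -> t <= b ->
      G t - G s = \int[lebesgue_measure]_(x in `]s, t]) g x].
Proof.
move=> Gnd Hnd; pose H x := x - G x.
have Gdist x y : `|G x - G y| <= `|x - y|.
  wlog yx : x y / y <= x.
    by move=> h; have [/h//|/ltW /h] := leP y x; rewrite distrC (distrC y).
  by have := Gnd _ _ yx; have := Hnd _ _ yx => /= ? ?; rewrite !ger0_norm; lra.
have Gc : continuous G.
  move=> x; apply/cvgrPdist_lt => e e0; near=> y.
  apply: (le_lt_trans (Gdist _ _)); near: y.
  exact: (@cvgr_dist_lt _ _ _ _ _ id x).
have Hc : continuous H by move=> x; apply: cvgB; [exact: cvg_id|exact: Gc].
pose Gm : cumulative R R := HB.pack G
  (isCumulative.Build R _ R G Gnd (right_continuousW Gc)).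
pose Hm : cumulative R R := HB.pack H
  (isCumulative.Build R _ R H Hnd (right_continuousW Hc)).
have GHE A : measurable A -> (lebesgue_measure A =
  lebesgue_stieltjes_measure Gm A + lebesgue_stieltjes_measure Hm A)%E.
  by apply: lebesgue_stieltjes_additive => x /=; rewrite /H; lra.
pose D : set (measurableTypeR R) := `]a, b]%classic.
have mD : measurable D by exact: measurable_itv.
have Goo : (lebesgue_stieltjes_measure Gm D < +oo)%E.
  have [ab|ab] := leP a b; first by rewrite lebesgue_stieltjes_itvoc// ltry.
  by rewrite /D set_itv_ge ?measure0// bnd_simp -leNgt ltW.
pose nu : {finite_measure set _ -> \bar R} := mfrestr mD Goo.
have nuE A : measurable A -> A `<=` D -> nu A = lebesgue_stieltjes_measure Gm A.
  by move=> mA AD; rewrite /nu/= /mfrestr /mrestr setIidl.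
have nu_le A : measurable A -> (nu A <= lebesgue_measure A)%E.
  move=> mA; rewrite GHE//; apply: (@le_trans _ _ (lebesgue_stieltjes_measure Gm A)).
    by apply: le_measure; rewrite ?inE//; exact: measurableI.
  by rewrite leeDl.
have [g [mg g01 gE]] := radon_nikodym_le1 _ _ _ lebesgue_measure _ nu_le.
exists g; split => // s t sa st tb.
rewrite /Rintegral -gE//.
rewrite nuE ?lebesgue_stieltjes_itvoc//.
by apply: subset_itv; rewrite bnd_simp.
Unshelve. all: by end_near. Qed.

Lemma lebesgue_aeS {R : realType} (P Q : R -> Prop) :
  (forall x, P x -> Q x) -> {ae @lebesgue_measure R, forall x, P x} ->
  {ae @lebesgue_measure R, forall x, Q x}.
Proof.
move=> PQ; apply: filterS => //.
exact: (ae_filter_ringOfSetsType (@lebesgue_measure R)).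
Qed.

Lemma lebesgue_aeI {R : realType} (P Q : R -> Prop) :
  {ae @lebesgue_measure R, forall x, P x} ->
  {ae @lebesgue_measure R, forall x, Q x} ->
  {ae @lebesgue_measure R, forall x, P x /\ Q x}.
Proof.
move=> aeP aeQ; apply: filterI => //.
exact: (ae_filter_ringOfSetsType (@lebesgue_measure R)).
Qed.

Lemma bounded_integrable_itv {R : realType} (g : R -> R) (L a b : R) :
  measurable_fun setT g -> (forall x, `|g x| <= L) ->
  lebesgue_measure.-integrable `]a, b] (EFin \o g).
Proof.
move=> mg gL; apply: measurable_bounded_integrable; first exact: measurable_itv.
- by rewrite /= lebesgue_measure_itv/=; case: ifPn => _; rewrite ?ltry.
- exact: measurable_funTS.
- by exists L; split => [|M LM x _ /=]; rewrite ?num_real// (le_trans (gL x) (ltW LM)).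
Qed.

(** Since [phi / L] is 1-Lipschitz, both [(x + phi x / L) / 2] and [(x - phi x / L) / 2] are
    nondecreasing. They sum to [x], so the first has a density [g] with values in [0, 1]; undoing
    the affine change turns it into [L * (2 * g - 1)]. *)
Lemma lipschitz_density {R : realType} (phi : R -> R) (L a b : R) : 0 < L ->
  (forall x y, `|phi x - phi y| <= L * `|x - y|) ->
  exists rho : R -> R, [/\ measurable_fun setT rho, (forall x, `|rho x| <= L) &
    forall s t, a <= s -> s <= t -> t <= b ->
      phi t - phi s = \int[lebesgue_measure]_(x in `]s, t]) rho x].
Proof.
move=> L0 phiL; pose G x := (phi x / L + x) / 2.
have phi_le x y : x <= y -> - (y - x) <= phi y / L - phi x / L <= y - x.
  move=> xy; rewrite -ler_norml -mulrBl normrM normfV (gtr0_norm L0).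
  by rewrite ler_pdivrMr// mulrC -[X in L * X]ger0_norm ?subr_ge0.
have [||g [mg g01 gE]] := bounded_density G a b.
- by move=> x y xy; have := phi_le _ _ xy; rewrite /G; lra.
- by move=> x y xy; have := phi_le _ _ xy; rewrite /G; lra.
have g1 x : `|g x| <= 1 by have /andP[? ?] := g01 x; rewrite ger0_norm.
exists (fun x => L * (2 * g x - 1)); split.
- by apply: measurable_funM => //; apply: measurable_funB => //; exact: measurable_funM.
- move=> x; rewrite normrM (gtr0_norm L0) ger_pMr// ler_norml.
  by have := g01 x; lra.
- move=> s t sa st tb.
  have int1 : lebesgue_measure.-integrable `]s, t] (EFin \o cst (1 : R)).
    by apply: (bounded_integrable_itv _ 1) => // x; rewrite normr1.
  have intg : lebesgue_measure.-integrable `]s, t] (EFin \o g).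
    exact: (bounded_integrable_itv _ 1).
  have int2g : lebesgue_measure.-integrable `]s, t] (EFin \o (fun x => 2 * g x)).
    apply: (bounded_integrable_itv _ 2); first exact: measurable_funM.
    by move=> x; rewrite normrM ger0_norm// ler_piMr.
  rewrite RintegralZl//; last first.
    apply: (bounded_integrable_itv _ 1).
      by apply: measurable_funB => //; exact: measurable_funM.
    by move=> x; rewrite ler_norml; have := g01 x; lra.
  rewrite RintegralB// RintegralZl// -gE// Rintegral_cst//.
  rewrite mul1r /= lebesgue_measure_itv/= lte_fin.
  have -> : fine (if s < t then (t%:E - s%:E)%E else 0) = t - s.
    by case: ifPn => //; rewrite -leNgt /= => ts; lra.
  by rewrite /G; field; rewrite gt_eqF.
Qed.

(** * Lebesgue differentiation *)

(** A division-free form of differentiability at [x] with derivative [c]; [h] may be zero or of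
    either sign. *)
Definition expands {R : realType} (F : R -> R) (x c : R) :=
  forall e : R, 0 < e -> exists2 d, 0 < d &
    forall h, `|h| < d -> `|F (x + h) - F x - c * h| <= e * `|h|.

Lemma derivable_expands {R : realType} (F : R -> R) (x : R) :
  derivable F x 1 -> expands F x (derive1 F x).
Proof.
move=> dF e e0.
have : (fun h : R => h^-1 *: (F (h *: 1 + x) - F x)) @ 0^' --> derive1 F x.
  rewrite derive1E; exact: dF.
move/cvgrPdist_le => /(_ e e0) /nbhs_ballP[d /= d0 dP].
exists d => // h hd; have [->|h0] := eqVneq h 0.
  by rewrite addr0 subrr mulr0 subr0 normr0 mulr0.
have /= := dP h; rewrite /ball/= sub0r normrN => /(_ hd h0).
rewrite -(ler_pM2r (_ : 0 < `|h|)) ?normr_gt0// -normrM => /(le_trans _); apply.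
rewrite distrC /GRing.scale/= mulr1 [h + x]addrC.
rewrite le_eqVlt; apply/orP; left; apply/eqP; congr `|_|.
by field.
Qed.

Lemma bounded_FTC1 {R : realType} (g : R -> R) (L a : R) :
  measurable_fun setT g -> (forall x, `|g x| <= L) ->
  {ae @lebesgue_measure R, forall x, a < x ->
    expands (fun y => \int[lebesgue_measure]_(t in `]a, y]) g t) x (g x)}.
Proof.
move=> mg gL.
have /FTC1 : forall y, lebesgue_measure.-integrable `]a, y] (EFin \o g).
  by move=> y; exact: bounded_integrable_itv gL.
have lg : locally_integrable setT g.
  split => //; first exact: openT.
  move=> K _ cK; apply: (@le_lt_trans _ _ (\int[lebesgue_measure]_(x in K) cst L%:E x)%E).
    have mK := compact_measurable cK.
    apply: ge0_le_integral => //=.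
    - apply/measurable_EFinP; apply/measurableT_comp => //; exact: measurable_funTS.
    - by move=> x _; rewrite lee_fin (le_trans _ (gL x)).
  rewrite integral_cst; last exact: compact_measurable.
  rewrite lte_mul_pinfty ?lee_fin ?(le_trans _ (gL 0))//.
  exact: compact_finite_measure.
move=> /(_ lg); apply: lebesgue_aeS => x + ax.
move=> -[]; first by rewrite lte_fin.
by move=> /derivable_expands + gx; rewrite gx.
Qed.

Lemma expands_integral {R : realType} (phi rho : R -> R) (L a b : R) :
  measurable_fun setT rho -> (forall x, `|rho x| <= L) ->
  (forall s t, a <= s -> s <= t -> t <= b ->
      phi t - phi s = \int[lebesgue_measure]_(x in `]s, t]) rho x) ->
  {ae @lebesgue_measure R, forall x, a < x < b -> expands phi x (rho x)}.
Proof.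
move=> mrho rhoL phiE; have := bounded_FTC1 rho L a mrho rhoL.
apply: lebesgue_aeS => x + /andP[ax xb] e e0 => /(_ ax e e0)[d d0 dP].
(* The last two bounds keep [x + h] between [a] and [b], where [phi] is the primitive of [rho] up to
   the constant [phi a]. *)
exists (Num.min d (Num.min (x - a) (b - x))); first by rewrite !lt_min d0 !subr_gt0 ax xb.
move=> h; rewrite !lt_min => /and3P[hd]; rewrite !ltr_norml.
move=> /andP[ha1 ha2] /andP[hb1 hb2].
have -> : phi (x + h) - phi x = (phi (x + h) - phi a) - (phi x - phi a) by ring.
by rewrite !phiE; [exact: dP|lra..].
Qed.

(** * Lipschitz extension from a set and distance to a set *)

(** For [u = 0] and [L = 1] this is the distance from [t] to [S], a case used below for porosity. *)
Definition mcshane {R : realType} (S : set R) (u : R -> R) (L t : R) : R :=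
  inf [set u s + L * `|t - s| | s in S].

Section mcshane.
Context {R : realType} (S : set R) (u : R -> R) (L : R).
Context (L0 : 0 <= L) (S0 : S !=set0).
Context (uL : forall s t, S s -> S t -> `|u s - u t| <= L * `|s - t|).

Lemma mcshane_has_inf t : has_inf [set u s + L * `|t - s| | s in S].
Proof.
case: S0 => s0 Ss0; split; first by exists (u s0 + L * `|t - s0|), s0.
exists (u s0 - L * `|t - s0|) => _ [s Ss <-].
have := uL _ _ Ss0 Ss; rewrite ler_norml => /andP[_ h].
have : L * `|s0 - s| <= L * `|t - s0| + L * `|t - s|.
  by rewrite -mulrDr ler_wpM2l// (distrC t s0) ler_distD.
by lra.
Qed.

Lemma mcshane_le t s : S s -> mcshane S u L t <= u s + L * `|t - s|.
Proof.
by move=> Ss; apply: ge_inf; [have [] := mcshane_has_inf t|exists s].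
Qed.

Lemma mcshane_ge t c : (forall s, S s -> c <= u s + L * `|t - s|) ->
  c <= mcshane S u L t.
Proof.
move=> h; apply: lb_le_inf; first by have [] := mcshane_has_inf t.
by move=> _ [s Ss <-]; exact: h.
Qed.

Lemma mcshaneE t : S t -> mcshane S u L t = u t.
Proof.
move=> St; apply/eqP; rewrite eq_le; apply/andP; split.
  by have := mcshane_le t t St; rewrite subrr normr0 mulr0 addr0.
apply: mcshane_ge => s Ss.
by have := uL _ _ St Ss; rewrite ler_norml => /andP[_]; lra.
Qed.

Lemma mcshane_lipschitz x y :
  `|mcshane S u L x - mcshane S u L y| <= L * `|x - y|.
Proof.
have h a b : mcshane S u L a - mcshane S u L b <= L * `|a - b|.
  suff : mcshane S u L a - L * `|a - b| <= mcshane S u L b by lra.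
  apply: mcshane_ge => s Ss; have := mcshane_le a s Ss.
  have : L * `|a - s| <= L * `|a - b| + L * `|b - s|.
    by rewrite -mulrDr ler_wpM2l// ler_distD.
  by lra.
by rewrite ler_norml; have := h x y; have := h y x; rewrite (distrC y x); lra.
Qed.

Lemma mcshane_adherent t (e : R) : 0 < e ->
  exists2 s, S s & u s + L * `|t - s| < mcshane S u L t + e.
Proof.
move=> e0; have [_ [s Ss <-] ?] := inf_adherent e0 (mcshane_has_inf t).
by exists s.
Qed.

End mcshane.

(* The distance to [S] is 1-Lipschitz and minimal on [S], so its derivative
   vanishes at almost every point of [S]. *)
Lemma ae_not_porous {R : realType} (S : set R) (a b : R) : S `<=` `]a, b[ ->
  {ae @lebesgue_measure R, forall x, S x -> forall e : R, 0 < e ->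
    exists2 d, 0 < d & forall h, `|h| < d ->
      exists2 s, S s & `|x + h - s| <= e * `|h|}.
Proof.
move=> Sab; have [->|S0] := eqVneq S set0; first exact: aeW.
move/set0P in S0.
have u0 : forall s t, S s -> S t -> `|(cst 0 : R -> R) s - cst 0 t| <= 1 * `|s - t|.
  by move=> s t _ _; rewrite subrr normr0 mul1r.
pose D := mcshane S (cst 0) 1.
have [rho [mrho rho1 rhoE]] :=
  lipschitz_density D 1 a b ltr01 (mcshane_lipschitz _ _ _ ler01 S0 u0).
have := expands_integral _ _ _ _ _ mrho rho1 rhoE.
apply: lebesgue_aeS => x + Sx e e0.
have := Sab _ Sx; rewrite /= in_itv/= => -> /(_ isT (e / 4)).
case; first by rewrite divr_gt0.
move=> d d0 dP; exists d => // h hd.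
have [->|h0] := eqVneq h 0.
  by exists x; rewrite // addr0 subrr normr0 mulr0.
have Dx : D x = 0 by exact: mcshaneE.
have Dge0 y : 0 <= D y by apply: mcshane_ge => // s Ss; rewrite add0r mul1r.
have nh0 : 0 < `|h| by rewrite normr_gt0.
have Dh : D (x + h) <= e / 2 * `|h|.
  (* The slope [rho x] need not be computed: it cancels when the expansions at [h] and [- h] are
     added. As [D x = 0] and [D >= 0], the sum of two errors [e / 4 * |h|] bounds [D (x + h)]
     alone. *)
  have := dP (- h); rewrite normrN => /(_ hd); have := dP h hd.
  rewrite Dx !ler_norml; have := Dge0 (x - h); have := Dge0 (x + h).
  by lra.
have [|s Ss] := mcshane_adherent S (cst 0) 1 ler01 S0 u0 (x + h) (e / 2 * `|h|).
  by rewrite mulr_gt0// divr_gt0.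
rewrite add0r mul1r -/D => hs; exists s => //.
by lra.
Qed.

(** * Metric derivative along a set where [f] is Lipschitz *)

(** One point of [S] is chosen in each rational interval that meets [S]; all other indices receive
    the default [s0]. *)
Lemma countable_dense_subset {R : realType} (S : set R) : S !=set0 ->
  exists d : nat -> R, (forall n, S (d n)) /\
    forall x (e : R), S x -> 0 < e -> exists n, `|x - d n| < e.
Proof.
move=> [s0 Ss0].
pose I (pq : rat * rat) := S `&` [set y | ratr pq.1 < y < ratr pq.2].
pose c pq : R := if pselect (I pq !=set0) is left h then sval (cid h) else s0.
exists (fun n => if unpickle n is Some pq then c pq else s0); split.
  move=> n; case: unpickle => // pq; rewrite /c; case: pselect => // h.
  by case: cid => y [].
move=> x e Sx e0.
have [|p] := @rat_in_itvoo R (x - e / 2) x; first by lra.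
rewrite in_itv/= => /andP[p1 p2].
have [|q] := @rat_in_itvoo R x (x + e / 2); first by lra.
rewrite in_itv/= => /andP[q1 q2].
exists (pickle (p, q)); rewrite pickleK /c; case: pselect => [h|[]]; last first.
  by exists x; split => //=; rewrite p2 q1.
by case: cid => y /= [_ /andP[/= y1 y2]]; rewrite ltr_norml; lra.
Qed.

Lemma measurable_bounded_sup {R : realType} (g : nat -> R -> R) (L : R) :
  (forall n, measurable_fun setT (g n)) -> (forall n x, `|g n x| <= L) ->
  exists m : R -> R, [/\ measurable_fun setT m, (forall x, 0 <= m x <= L),
    (forall n x, `|g n x| <= m x) &
    forall x (e : R), 0 < e -> exists n, m x - e < `|g n x|].
Proof.
move=> mg gL; pose u x n := `|g n x|.
pose m x := sups (u x) 0%N.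
have hs x : has_sup (sdrop (u x) 0).
  split; first by exists (u x 0%N), 0%N.
  by exists L => _ [n _ <-]; exact: gL.
have um n x : u x n <= m x.
  by apply: ub_le_sup; [have [] := hs x|exists n].
exists m; split => //.
- apply: measurable_fun_sups.
    by move=> x _; exists L => _ [n _ <-]; exact: gL.
  by move=> n; apply: measurableT_comp.
- move=> x; rewrite (le_trans (normr_ge0 _) (um 0%N x)) /=.
  apply: ge_sup; first by have [] := hs x.
  by move=> _ [n _ <-]; exact: gL.
- by move=> x e e0; have [_ [n _ <-]] := sup_adherent e0 (hs x); exists n.
Qed.

Lemma ae_metric_derivative_within {R : realType} {X : normedModType R}
    (f : R -> X) (S : set R) (L a b : R) : 0 < L -> S `<=` `]a, b[ ->
  (forall s t, S s -> S t -> `|f s - f t| <= L * `|s - t|) ->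
  exists m : R -> R, (forall x, 0 <= m x <= L) /\
  {ae @lebesgue_measure R, forall x, S x -> forall e : R, 0 < e ->
    exists2 d, 0 < d & forall h, `|h| < d -> S (x + h) ->
      `| `|f (x + h) - f x| - m x * `|h| | <= e * `|h|}.
Proof.
move=> L0 Sab fL; have [->|S0] := eqVneq S set0.
  by exists (cst 0); split; [move=> x; rewrite lexx ltW|exact: aeW].
move/set0P in S0.
have [d [Sd dd]] := countable_dense_subset S S0.
pose u n t := `|f t - f (d n)|.
have uL n s t : S s -> S t -> `|u n s - u n t| <= L * `|s - t|.
  move=> Ss St; apply: le_trans (fL _ _ Ss St); rewrite /u.
  by apply: le_trans (ler_dist_dist _ _) _; rewrite opprB addrA subrK.
pose phi n := mcshane S (u n) L.
have phiE n t : S t -> phi n t = u n t by move=> St; apply: mcshaneE => //; [exact: ltW|exact: uL].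
have [rho rhoP] := choice (fun n => lipschitz_density (phi n) L a b L0
  (mcshane_lipschitz S (u n) L (ltW L0) S0 (uL n))).
have mrho n : measurable_fun setT (rho n) by have [] := rhoP n.
have rhoL n x : `|rho n x| <= L by have [] := rhoP n.
have rhoE n s t : a <= s -> s <= t -> t <= b -> phi n t - phi n s =
    \int[lebesgue_measure]_(x in `]s, t]) rho n x by have [_ _] := rhoP n; exact.
have [m [mm m0L rhom mrho_adh]] := measurable_bounded_sup rho L mrho rhoL.
exists m; split => //.
have mL x : `|m x| <= L by have /andP[? ?] := m0L x; rewrite ger0_norm.
pose M y := \int[lebesgue_measure]_(t in `]a, y]) m t.
have ME s t : a <= s -> s <= t -> t <= b ->
    M t - M s = \int[lebesgue_measure]_(x in `]s, t]) m x.
  move=> sa st tb; rewrite /M Rintegral_itvB ?bnd_simp//.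
  exact: bounded_integrable_itv mL.
have fM s t : S s -> S t -> s <= t -> `|f t - f s| <= M t - M s.
  move=> Ss St st; apply/ler_addgt0Pr => e e0.
  (* With [d n] this close to [s], replacing [|f t - f s|] by [u n t - u n s] loses at most
     [2 * u n s <= e]. *)
  have [|n sn] := dd s (e / (2 * L)) Ss; first by rewrite divr_gt0// mulr_gt0.
  have fsn : u n s <= e / 2.
    apply: le_trans (fL _ _ Ss (Sd n)) _.
    have -> : e / 2 = L * (e / (2 * L)) by field; rewrite gt_eqF.
    by rewrite ler_pM2l// ltW.
  have : phi n t - phi n s <= M t - M s.
    have := Sab _ Ss; have := Sab _ St; rewrite /= !in_itv/=.
    move=> /andP[_ /ltW tb] /andP[/ltW sa _].
    rewrite rhoE// ME//; apply: le_Rintegral => //.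
    - exact: bounded_integrable_itv (rhoL n).
    - exact: bounded_integrable_itv mL.
    - by move=> x _; exact: le_trans (ler_norm _) (rhom n x).
  rewrite !phiE// {1}/u.
  have : `|f t - f s| <= `|f t - f (d n)| + u n s.
    by rewrite /u (distrC (f s)) ler_distD.
  by lra.
have := expands_integral M m L a b mm mL ME.
have /ae_foralln := fun n =>
  expands_integral (phi n) (rho n) L a b (mrho n) (rhoL n) (rhoE n).
move=> /lebesgue_aeI aeI /aeI {aeI}; apply: lebesgue_aeS => x [+ +] Sx e e0.
have := Sab _ Sx; rewrite /= in_itv/= => xab.
have e20 : 0 < e / 2 by rewrite divr_gt0.
(* The lower bound uses a single [phi n], chosen after [x] and [e]. Half of [e] pays for [|rho n x|]
   falling short of the supremum [m x], half for the expansion of [phi n]. The upper bound uses the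
   primitive [M] instead. *)
have [n mn] := mrho_adh x (e / 2) e20.
move=> /(_ n xab (e / 2) e20) [d1 d10 d1P].
move=> /(_ xab e e0) [d2 d20 d2P].
exists (Num.min d1 d2); first by rewrite lt_min d10.
move=> h; rewrite lt_min => /andP[/d1P h1 /d2P h2] Sxh.
have nh0 := normr_ge0 h.
rewrite ler_norml; apply/andP; split.
  have : `|phi n (x + h) - phi n x| <= `|f (x + h) - f x|.
    rewrite !phiE//; apply: le_trans (ler_dist_dist _ _) _.
    by rewrite opprB addrA subrK.
  have : `|rho n x| * `|h| <= `|phi n (x + h) - phi n x| + e / 2 * `|h|.
    rewrite -normrM -lerBlDl; apply: le_trans h1.
    by rewrite (distrC _ (rho n x * h)); exact: lerB_dist.
  have : (m x - e / 2) * `|h| <= `|rho n x| * `|h| by rewrite ler_wpM2r// ltW.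
  by lra.
have : `|f (x + h) - f x| <= `|M (x + h) - M x|.
  have [h0|h0] := leP 0 h.
    by apply: le_trans (ler_norm _); apply: fM => //; lra.
  rewrite distrC (distrC (M _)).
  by apply: le_trans (ler_norm _); apply: fM => //; lra.
have : `|M (x + h) - M x| <= m x * `|h| + e * `|h|.
  have -> : m x * `|h| = `|m x * h|.
    by rewrite normrM (ger0_norm (_ : 0 <= m x))//; have /andP[] := m0L x.
  rewrite -lerBlDl; apply: le_trans h2.
  exact: lerB_dist.
by lra.
Qed.

(** * From increments within the set to all increments *)

Definition metric_expands {R : realType} {X : normedModType R} (f : R -> X)
    (x m : R) :=
  forall e : R, 0 < e -> exists2 d, 0 < d &
    forall h, `|h| < d -> `| `|f (x + h) - f x| - m * `|h| | <= e * `|h|.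

(** The hypothesis does two jobs. As [S] lies in an interval of length [b - a], it makes [f]
    Lipschitz on [S], which gives the expansion along [S]. It also bounds [f] at points outside [S],
    which transfers the expansion from a nearby [s] in [S] to [x + h]. *)
Lemma ae_metric_expands {R : realType} {X : normedModType R} (f : R -> X)
    (S : set R) (L a b : R) : 0 < L -> S `<=` `]a, b[ ->
  (forall x t, S x -> 0 < t < b - a -> `|f (x + t) - f x| <= L * t) ->
  {ae @lebesgue_measure R, forall x, S x -> exists m, metric_expands f x m}.
Proof.
move=> L0 Sab fS.
have fL s t : S s -> S t -> `|f s - f t| <= L * `|s - t|.
  wlog st : s t / s <= t.
    move=> H; have [st|/ltW ts] := leP s t; first exact: H.
    by move=> ? ?; rewrite distrC (distrC s); exact: H.
  move=> Ss St; have [->|nst] := eqVneq s t; first by rewrite !subrr !normr0 mulr0.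
  have := Sab _ St; have := Sab _ Ss; rewrite /= !in_itv/=.
  move=> /andP[s1 s2] /andP[t1 t2].
  have st' : s < t by rewrite lt_neqAle nst.
  rewrite distrC (distrC s) (ger0_norm (_ : 0 <= t - s)) ?subr_ge0//.
  by rewrite -{1}(subrKC s t); apply: fS => //; lra.
have [m [m0L mP]] := ae_metric_derivative_within f S L a b L0 Sab fL.
have := lebesgue_aeI _ _ mP (ae_not_porous S a b Sab).
apply: lebesgue_aeS => x [+ +] Sx => /(_ Sx) mx /(_ Sx) px.
exists (m x) => e e0.
have /andP[mx0 mxL] := m0L x.
have ab : 0 < b - a by have := Sab _ Sx; rewrite /= in_itv/= => /andP[? ?]; lra.
(* Three errors add up to [(4 * L + 3) * k * |h|]: [2 * L] from [f (x + h)] against [f s], [2 * L]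
   from [m x * |s - x|] against [m x * |h|], and 3 from the expansion at [s], since
   [|s - x| <= 3 * |h|]. *)
pose k := Num.min 1 (e / (4 * L + 3)).
have k0 : 0 < k by rewrite lt_min ltr01 divr_gt0//; lra.
have k1 : k <= 1 by rewrite ge_min lexx.
have ke : (4 * L + 3) * k <= e.
  have -> : e = (4 * L + 3) * (e / (4 * L + 3)) by field; rewrite gt_eqF//; lra.
  by rewrite ler_wpM2l; [|lra|rewrite ge_min lexx orbT].
have [d1 d10 d1P] := mx k k0.
have [|d2 d20 d2P] := px (k / 4); first by rewrite divr_gt0.
(* These give in turn [|s - x| <= 3 * |h| < d1], [|h - k * |h|| <= 2 * |h| < d2] and
   [x + h - s <= 2 * |h| < b - a]. *)
exists (Num.min (d1 / 3) (Num.min (d2 / 2) ((b - a) / 2))).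
  by rewrite !lt_min !divr_gt0.
move=> h; rewrite !lt_min => /and3P[hd1 hd2 hab].
have [->|h0] := eqVneq h 0; first by rewrite addr0 subrr !normr0 !mulr0 subrr normr0.
have nh0 : 0 < `|h| by rewrite normr_gt0.
have kh : k * `|h| <= `|h| by rewrite ler_piMl// ltW.
have kh0 : 0 < k * `|h| by rewrite mulr_gt0.
have hk2 : `|h - k * `|h| | <= 2 * `|h|.
  apply: le_trans (ler_normB _ _) _.
  by rewrite (ger0_norm (ltW kh0)); lra.
(* Since one-sided control at [s] only sees points to its right, [s] is looked
   for near a point slightly to the left of [x + h]. *)
have [|s Ss] := d2P (h - k * `|h|); first by lra.
have : k / 4 * `|h - k * `|h| | <= k / 4 * (2 * `|h|) by rewrite ler_wpM2l// ltW// divr_gt0.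
move=> /[swap] /le_trans /[apply]; rewrite ler_norml => /andP[s1 s2].
(* The point [s] is within [k * |h| / 2] of [x + h - k * |h|], hence strictly to the left of
   [x + h]. *)
have sh1 : 0 < x + h - s by lra.
have sh2 : x + h - s <= 2 * (k * `|h|) by lra.
have fs : `|f (x + h) - f s| <= 2 * L * (k * `|h|).
  have -> : x + h = s + (x + h - s) by ring.
  apply: le_trans (fS _ _ Ss _) _; first by lra.
  by rewrite [X in _ <= X](_ : _ = L * (2 * (k * `|h|))) ?ler_pM2l//; ring.
have nhh : `| `|s - x| - `|h| | <= 2 * (k * `|h|).
  apply: le_trans (ler_dist_dist _ _) _.
  by rewrite ler_norml; lra.
have nhh' := nhh; move: nhh'; rewrite ler_norml => /andP[nhh1 nhh2].
have := d1P (s - x); rewrite subrKC => /(_ _ Ss).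
have sx3 : `|s - x| <= 3 * `|h| by lra.
move=> /(_ (le_lt_trans sx3 _)) fsx.
have {}fsx : `| `|f s - f x| - m x * `|s - x| | <= 3 * (k * `|h|).
  apply: le_trans (fsx _) _; first by lra.
  by rewrite mulrCA ler_pM2l.
have mh : `| m x * (`|s - x| - `|h|) | <= 2 * L * (k * `|h|).
  rewrite normrM (ger0_norm mx0) [X in _ <= X](_ : _ = L * (2 * (k * `|h|))); last by ring.
  exact: ler_pM.
have ff : `| `|f (x + h) - f x| - `|f s - f x| | <= 2 * L * (k * `|h|).
  by apply: le_trans fs; apply: le_trans (ler_dist_dist _ _) _; rewrite opprB addrA subrK.
have : (4 * L + 3) * k * `|h| <= e * `|h| by rewrite ler_pM2r.
move: ff mh fsx; rewrite !ler_norml => /andP[? ?] /andP[? ?] /andP[? ?].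
by lra.
Qed.

(** * Upper limits, one-sided quotients and the countable decomposition *)

(** The set where [g <= l + e] belongs to [F] and bounds the upper limit from above; every member of
    [F] meets the set where [g >= l - e], which bounds it from below. *)
Lemma limf_esup_cvg {I : choiceType} {T : filteredType I} {R : realType}
    {F : set_system T}
    {FF : ProperFilter F} (g : T -> R) (l : R) :
  g @ F --> l -> limf_esup (EFin \o g) F = l%:E.
Proof.
move=> gl; apply/eqP; rewrite eq_le; apply/andP; split.
  apply/lee_addgt0Pr => e e0.
  apply: (@le_trans _ _ (ereal_sup ((EFin \o g) @` [set t | g t <= l + e]))).
    apply: ereal_inf_lbound; exists [set t | g t <= l + e] => //.
    near=> t; rewrite /= -lerBlDl.
    apply: le_trans (ler_norm _) _; rewrite distrC.
    by near: t; move/cvgrPdist_le : gl; exact.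
  by apply: ge_ereal_sup => _ [t /= ? <-]; rewrite -EFinD lee_fin.
apply: le_ereal_inf_tmp => _ [V FV <-]; apply/lee_subgt0Pr => e e0.
have FVe : F (V `&` [set t | l - e <= g t]).
  apply: filterI => //; near=> t; rewrite /= lerBlDr -lerBlDl.
  apply: le_trans (ler_norm _) _.
  by near: t; move/cvgrPdist_le : gl; exact.
have [t [Vt /= lt]] := filter_ex FVe.
apply: (@le_trans _ _ (g t)%:E); first by rewrite -EFinB lee_fin.
by apply: ereal_sup_ubound; exists t.
Unshelve. all: by end_near. Qed.

Lemma metric_expands_cvg {R : realType} {X : normedModType R} (f : R -> X)
    (x m : R) : metric_expands f x m ->
  (rquot f x t @[t --> 0^'+] --> m) /\ (lquot f x t @[t --> 0^'+] --> m).
Proof.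
(* One computation serves both sides: [g] is the identity for [rquot] and the opposite for
   [lquot]. *)
move=> fm; have H (g : R -> R) : (forall t, `|g t| = `|t|) ->
    (`|f (x + g t) - f x| / t) @[t --> 0^'+] --> m.
  move=> gE; apply/cvgrPdist_le => e e0; have [d d0 dP] := fm e e0.
  near=> t; have t0 : 0 < t by near: t; exact: nbhs_right_gt.
  have td : t < d by near: t; exact: nbhs_right_lt.
  have := dP (g t); rewrite gE (gtr0_norm t0) => /(_ td) dPt.
  rewrite distrC -(ler_pM2r t0) -[X in _ * X](gtr0_norm t0) -normrM.
  by rewrite mulrBl divfK ?gt_eqF.
by split; [exact: (H id)|exact: (H -%R (@normrN _ _))].
Unshelve. all: by end_near. Qed.

(** One integer serves both as slope bound and, inverted, as radius, so that countably many
    conditions cover all points with finite [mDplus]. *)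
Lemma mDplus_lty {R : realType} {X : normedModType R} (f : R -> X) (x : R) :
  (mDplus f x < +oo)%E -> exists n : nat,
    forall t, 0 < t < n.+1%:R^-1 -> `|f (x + t) - f x| <= n.+1%:R * t.
Proof.
rewrite /mDplus limf_esupE => /ereal_inf_lt[_ [V V0 <-]] Voo.
have [M VM] : exists M : R, forall t, V t -> rquot f x t <= M.
  exists (fine (ereal_sup ((fun t : R => (rquot f x t)%:E) @` V))) => t Vt.
  have Vle : ((rquot f x t)%:E <= ereal_sup ((fun t => (rquot f x t)%:E) @` V))%E.
    by apply: ereal_sup_ubound; exists t.
  (* The point [t] of [V] keeps the supremum above -oo, so [fine] preserves its value. *)
  rewrite -lee_fin fineK// fin_numElt Voo andbT.
  exact: lt_le_trans (ltNyr _) Vle.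
have [d /= d0 dV] : exists2 d : R, 0 < d & forall t, 0 < t < d -> V t.
  move: V0 => /nbhs_ballP[d /= d0 dV]; exists d => // t /andP[t0 td].
  by apply: dV => //; rewrite /ball/= sub0r normrN gtr0_norm.
have [n nM] : exists n : nat, Num.max M d^-1 <= n.+1%:R.
  exists (Num.truncn (Num.max M d^-1)).
  by rewrite ltW// truncnS_gt.
move: nM; rewrite ge_max => /andP[nM nd]; exists n => t /andP[t0 tn].
rewrite -ler_pdivrMr//; apply: le_trans nM; apply: VM; apply: dV.
by rewrite t0 (lt_le_trans tn)// -[leRHS]invrK lef_pV2 ?posrE ?invr_gt0.
Qed.

Theorem theorem3p5 (R : realType) (X : completeNormedModType R) (f : R -> X) :
  exists N : set R,
    (@lebesgue_measure R).-negligible N /\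
    forall x : R, ~ N x -> (mDplus f x < +oo)%E ->
      md_exists f x /\ (md f x)%:E = mDplus f x.
Proof.
(* The interval is exactly as long as the radius of the one-sided bound, so that bound applies
   between any two points of [S n q]. *)
pose S (n : nat) (q : rat) : set R :=
  [set x | forall t, 0 < t < n.+1%:R^-1 -> `|f (x + t) - f x| <= n.+1%:R * t]
  `&` `]ratr q, ratr q + n.+1%:R^-1[.
(* The pairs [(n, q)] are enumerated by their codes; a number that codes no pair imposes no
   condition. *)
pose P k x := if unpickle k is Some (n, q)
  then S n q x -> exists m, metric_expands f x m else True.
have aeP k : {ae @lebesgue_measure R, forall x, P k x}.
  rewrite /P; case: (unpickle k) => [[n q]|]; last exact: aeW.
  apply: (ae_metric_expands f (S n q) n.+1%:R (ratr q) (ratr q + n.+1%:R^-1)) => //.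
    by move=> x [].
  by move=> x t [+ _]; rewrite [ratr q + _]addrC addrK => /(_ t).
exists [set x | ~ forall k, P k x]; split; first exact: ae_foralln.
move=> x /contrapT Px mDx; have [n nx] := mDplus_lty f x mDx.
have [|q] := @rat_in_itvoo R (x - n.+1%:R^-1) x.
  by rewrite ltrBlDr ltrDl invr_gt0.
rewrite in_itv/= => /andP[q1 q2].
have := Px (pickle (n, q)); rewrite /P pickleK.
case; first by split => //=; rewrite in_itv/= q2 -ltrBlDr.
move=> m /metric_expands_cvg[rm lm].
have rE : md_plus f x = m by apply/cvg_lim.
have lE : md_minus f x = m by apply/cvg_lim.
split; last by rewrite /md rE; apply/esym/limf_esup_cvg.
by split; [apply/cvg_ex; exists m|apply/cvg_ex; exists m|rewrite rE lE].
Qed.
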